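(* Let $A$ be a unital associative algebra over a field $\mathbb{K}$ of characteristic zero. (i) For every integer $k\ge -1$ and every $K\in\Omega^1_{k+1}(A)$, the formula $$j_K(\omega_0\otimes_A\cdots\otimes_A\omega_\ell)=\sum_{i=0}^{\ell}(-1)^{ik}\,\omega_0\otimes_A\cdots\otimes_A K(\omega_i)\otimes_A\cdots\otimes_A\omega_\ell\qquad(\ell\ge 0,\ \omega_i\in\Omega_1(A)),$$ together with $j_K|_{\Omega_0(A)}=0$, defines an algebraic graded derivation $j_K\in\operatorname{Der}_k\Omega(A)$. (ii) Every algebraic graded derivation of $\Omega(A)$ of degree $k$ is of the form $j_K$ for some $K\in\Omega^1_{k+1}(A)$. Consequently $K\mapsto j_K$ is a linear isomorphism from $\Omega^1_*(A)$ onto the space of algebraic graded derivations of $\Omega(A)$.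
   Context: $\Omega_1(A)$ is the kernel of the multiplication map $A\otimes_{\mathbb{K}} A\to A$, an $A$-bimodule; $\Omega_0(A)=A$; $\Omega_k(A)=\Omega_1(A)\otimes_A\cdots\otimes_A\Omega_1(A)$ ($k$ factors) for $k\ge1$; $\Omega_k(A)=0$ for $k<0$. $\Omega(A)=\bigoplus_{k\ge0}\Omega_k(A)$ is a graded algebra with the tensor product over $A$ as multiplication (universal differential forms). $\operatorname{Der}_k\Omega(A)$ is the space of graded derivations of degree $k$: $\mathbb{K}$-linear maps $D:\Omega(A)\to\Omega(A)$ with $D(\Omega_\ell(A))\subset\Omega_{k+\ell}(A)$ and $D(\varphi\psi)=D(\varphi)\psi+(-1)^{k\ell}\varphi D(\psi)$ for $\varphi\in\Omega_\ell(A)$, $\psi\in\Omega(A)$. $\operatorname{Der}\Omega(A)=\bigoplus_k\operatorname{Der}_k\Omega(A)$. A graded derivation $D$ is called algebraic if $D|_{\Omega_0(A)}=0$; the space of algebraic graded derivations is the direct sum over $k$ of the spaces of algebraic derivations of degree $k$. For $k\ge0$, $\Omega^1_k(A)$ denotes the space of $A$-bimodule homomorphisms $\Omega_1(A)\to\Omega_k(A)$, and $\Omega^1_*(A)=\bigoplus_{k\ge0}\Omega^1_k(A)$. The map $K\mapsto j_K$ is extended linearly to $\Omega^1_*(A)$. *)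

(* Defs.v *)
From HB Require Import structures.
From mathcomp Require Import all_boot all_order all_algebra.
From mathcomp Require Import boolp functions.

Set Implicit Arguments.
Unset Strict Implicit.
Unset Printing Implicit Defensive.

Import GRing.Theory.
Local Open Scope ring_scope.
Local Open Scope quotient_scope.

Section Submodule.
Variables (K : pzRingType) (V : lmodType K) (S : submodClosed V).

Record submodule := Submodule { submodule_val :> V; _ : submodule_val \in S }.

HB.instance Definition _ := [isSub for submodule_val].
HB.instance Definition _ := [Choice of submodule by <:].
HB.instance Definition _ := [SubChoice_isSubLmodule of submodule by <:].

End Submodule.

Section DirectSum.
Variables (K : pzRingType) (I : choiceType) (V : I -> lmodType K).

Record dsum := DSum {
  dsum_val :> forall i, V i;
  dsum_finite : exists s : seq I, forall i, i \notin s -> dsum_val i = 0 }.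

HB.instance Definition _ := gen_eqMixin dsum.
HB.instance Definition _ := gen_choiceMixin dsum.

Lemma dsumP (x y : dsum) : (forall i, x i = y i) -> x = y.
Proof.
case: x y => [x hx] [y hy] /= xy.
have E : x = y by apply: functional_extensionality_dep.
by case: y / E {xy} hy => hy; congr DSum; apply: Prop_irrelevance.
Qed.

Fact dsum0_subproof :
  exists s : seq I, forall i, i \notin s -> (0 : V i) = 0.
Proof. by exists [::]. Qed.
Definition dsum0 := DSum dsum0_subproof.

Fact dsumD_subproof (x y : dsum) :
  exists s : seq I, forall i, i \notin s -> x i + y i = 0.
Proof.
case: x y => [x [s hs]] [y [t ht]] /=; exists (s ++ t) => i.
by rewrite mem_cat negb_or => /andP[/hs -> /ht ->]; rewrite addr0.
Qed.
Definition dsumD x y := DSum (dsumD_subproof x y).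

Fact dsumZ_subproof (c : K) (x : dsum) :
  exists s : seq I, forall i, i \notin s -> c *: x i = 0.
Proof. by case: x => x [s hs]; exists s => i /hs /= ->; rewrite scaler0. Qed.
Definition dsumZ c x := DSum (dsumZ_subproof c x).

Fact dsumA : associative dsumD.
Proof. by move=> x y z; apply: dsumP => i /=; rewrite addrA. Qed.
Fact dsumC : commutative dsumD.
Proof. by move=> x y; apply: dsumP => i /=; rewrite addrC. Qed.
Fact dsum0D : left_id dsum0 dsumD.
Proof. by move=> x; apply: dsumP => i /=; rewrite add0r. Qed.
Fact dsumND : left_inverse dsum0 (dsumZ (-1)) dsumD.
Proof. by move=> x; apply: dsumP => i /=; rewrite scaleN1r addNr. Qed.
HB.instance Definition _ := GRing.isZmodule.Build dsum dsumA dsumC dsum0D dsumND.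

Fact dsumZA a b x : dsumZ a (dsumZ b x) = dsumZ (a * b) x.
Proof. by apply: dsumP => i /=; rewrite scalerA. Qed.
Fact dsumZ1 : left_id 1 dsumZ.
Proof. by move=> x; apply: dsumP => i /=; rewrite scale1r. Qed.
Fact dsumZDr : right_distributive dsumZ +%R.
Proof. by move=> c x y; apply: dsumP => i /=; rewrite scalerDr. Qed.
Fact dsumZDl x : {morph dsumZ^~ x : a b / a + b}.
Proof. by move=> a b; apply: dsumP => i /=; rewrite scalerDl. Qed.
HB.instance Definition _ :=
  GRing.Zmodule_isLmodule.Build K dsum dsumZA dsumZ1 dsumZDr dsumZDl.

Lemma dsum0E i : (0 : dsum) i = 0. Proof. by []. Qed.
Lemma dsumDE (x y : dsum) i : (x + y) i = x i + y i. Proof. by []. Qed.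
Lemma dsumZE c (x : dsum) i : (c *: x) i = c *: x i. Proof. by []. Qed.

Lemma dsum_sumE (J : Type) (r : seq J) (F : J -> dsum) i :
  (\sum_(j <- r) F j) i = \sum_(j <- r) F j i.
Proof. by elim/big_rec2: _ => // j x y _ <-. Qed.

Fact dinj_subproof i (v : V i) :
  exists s : seq I, forall j, j \notin s -> dfwith (fun j => 0 : V j) v j = 0.
Proof.
by exists [:: i] => j; rewrite inE; case: dfwithP => //; rewrite eqxx.
Qed.
Definition dinj i (v : V i) := DSum (dinj_subproof v).

Lemma dinj_in i (v : V i) : dinj v i = v. Proof. exact: dfwith_in. Qed.
Lemma dinj_out i (v : V i) j : i != j -> dinj v j = 0.
Proof. exact: dfwith_out. Qed.

Lemma dinjP i c (u v : V i) : dinj (c *: u + v) = c *: dinj u + dinj v.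
Proof.
apply: dsumP => j; rewrite dsumDE dsumZE.
have [<-|ij] := eqVneq i j; first by rewrite !dinj_in.
by rewrite !dinj_out // scaler0 addr0.
Qed.

Definition dsupp (x : dsum) : seq I := undup (projT1 (cid (dsum_finite x))).

Lemma dsuppP (x : dsum) i : i \notin dsupp x -> x i = 0.
Proof. by rewrite mem_undup; case: cid => s /= h /h. Qed.

(* Meaningful when every [F i] is linear: the sum is then independent of the
   chosen finite support, see [dliftE]. *)
Definition dlift (W : lmodType K) (F : forall i, V i -> W) (x : dsum) : W :=
  \sum_(i <- dsupp x) F i (x i).

Section Lift.
Variables (W : lmodType K) (F : forall i, V i -> W).
Hypothesis linF : forall i c (u v : V i),
  F (c *: u + v) = c *: F u + F v.

Let F0 i : F (0 : V i) = 0.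
Proof. by have := linF (-1) (0 : V i) 0; rewrite scaler0 addr0 scaleN1r addNr. Qed.

Lemma dliftE (s : seq I) (x : dsum) :
  uniq s -> (forall i, i \notin s -> x i = 0) ->
  dlift (@F) x = \sum_(i <- s) F (x i).
Proof.
move=> us hs; rewrite /dlift.
have E (t t' : seq I) : uniq t -> uniq t' ->
    (forall i, i \notin t' -> x i = 0) ->
    \sum_(i <- t) F (x i) = \sum_(i <- [seq i <- t | i \in t']) F (x i).
  move=> ut ut' h; rewrite big_filter [LHS](bigID (mem t')) /=.
  by rewrite [X in _ + X]big1 ?addr0 // => i /h ->.
rewrite (E (dsupp x) s) ?undup_uniq // (E s (dsupp x)) ?undup_uniq //.
  apply: perm_big; apply: uniq_perm; rewrite ?filter_uniq ?undup_uniq // => i.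
  by rewrite !mem_filter andbC.
exact: dsuppP.
Qed.

Lemma dlift_inj i (v : V i) : dlift (@F) (dinj v) = F v :> W.
Proof.
rewrite (@dliftE [:: i]) // ?big_seq1 ?dinj_in // => j.
by rewrite inE eq_sym => /dinj_out.
Qed.

Lemma dliftP c (x y : dsum) : dlift (@F) (c *: x + y) = c *: dlift (@F) x + dlift (@F) y.
Proof.
pose s := undup (dsupp x ++ dsupp y).
have us : uniq s by exact: undup_uniq.
have hs i : i \notin s -> x i = 0 /\ y i = 0.
  by rewrite mem_undup mem_cat negb_or => /andP[/dsuppP ? /dsuppP].
rewrite !(@dliftE s) //; try by move=> i /hs[].
  rewrite scaler_sumr -big_split /=; apply: eq_bigr => i _.
  by rewrite linF.
by move=> i /hs[xi yi]; rewrite dsumDE dsumZE xi yi scaler0 addr0.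
Qed.

End Lift.

Lemma dsum_ind (P : dsum -> Prop) :
  (forall c x y, P x -> P y -> P (c *: x + y)) ->
  (forall i v, P (@dinj i v)) -> P 0 -> forall x, P x.
Proof.
move=> PL Pi P0 x.
have -> : x = \sum_(i <- dsupp x) dinj (x i).
  apply: dsumP => j; rewrite dsum_sumE.
  have us : uniq (dsupp x) by exact: undup_uniq.
  have [js|js] := boolP (j \in dsupp x); last first.
    rewrite big1_seq ?dsuppP // => i /andP[_ ii].
    by rewrite dinj_out //; apply: contraNneq js => <-.
  rewrite (bigD1_seq j) // dinj_in big1 /= ?addr0 // => i ij.
  exact: dinj_out.
elim: dsupp => [|i s IHs]; first by rewrite big_nil.
by rewrite big_cons -[dinj _]scale1r; apply: PL.
Qed.

End DirectSum.

Section QuotientModule.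
Variables (K : pzRingType) (V : lmodType K) (S : submodClosed V).

Definition quotmod_pred : {pred V} := S.
Fact quotmod_pred_zmod : zmod_closed quotmod_pred.
Proof.
split=> [|u v Su Sv]; first exact: (@rpred0 _ S).
by rewrite -scaleN1r; apply: (@rpredD _ S) => //; apply: (@rpredZ _ _ S).
Qed.
HB.instance Definition _ :=
  GRing.isZmodClosed.Build V quotmod_pred quotmod_pred_zmod.

Definition quotmod := @Quotient.quot V quotmod_pred.
HB.instance Definition _ := GRing.Zmodule.on quotmod.

Definition quotmod_pi (x : V) : quotmod := \pi_(@Quotient.quot V quotmod_pred) x.
Definition quotmod_repr (q : quotmod) : V := repr q.

Lemma quotmod_reprK q : quotmod_pi (quotmod_repr q) = q.
Proof. exact: reprK. Qed.

Lemma quotmod_eqP x y : quotmod_pi x = quotmod_pi y <-> x - y \in S.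
Proof.
have E : (x - y \in S) = (quotmod_pi x == quotmod_pi y).
  exact: (Quotient.idealrBE quotmod_pred).
by rewrite E; split => /eqP.
Qed.

Lemma quotmod_piD x y : quotmod_pi (x + y) = quotmod_pi x + quotmod_pi y.
Proof. exact: raddfD. Qed.

Definition quotmod_scale c (q : quotmod) := quotmod_pi (c *: quotmod_repr q).

Lemma quotmod_piZ_sub c x :
  quotmod_pi (c *: x) = quotmod_scale c (quotmod_pi x).
Proof.
apply/quotmod_eqP; rewrite -scalerBr; apply: (@rpredZ _ _ S).
by apply/quotmod_eqP; rewrite quotmod_reprK.
Qed.

Fact quotmod_scaleA a b v :
  quotmod_scale a (quotmod_scale b v) = quotmod_scale (a * b) v.
Proof.
by rewrite -[v]quotmod_reprK -!quotmod_piZ_sub scalerA.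
Qed.
Fact quotmod_scale1 : left_id 1 quotmod_scale.
Proof. by move=> v; rewrite -[v]quotmod_reprK -!quotmod_piZ_sub scale1r. Qed.
Fact quotmod_scaleDr : right_distributive quotmod_scale +%R.
Proof.
move=> c u v; rewrite -[u]quotmod_reprK -[v]quotmod_reprK -quotmod_piD.
by rewrite -!quotmod_piZ_sub -quotmod_piD scalerDr.
Qed.
Fact quotmod_scaleDl v : {morph quotmod_scale^~ v : a b / a + b}.
Proof.
move=> a b; rewrite -[v]quotmod_reprK.
by rewrite -!quotmod_piZ_sub -quotmod_piD scalerDl.
Qed.
HB.instance Definition _ := GRing.Zmodule_isLmodule.Build K quotmod
  quotmod_scaleA quotmod_scale1 quotmod_scaleDr quotmod_scaleDl.

Lemma quotmod_piP c x y :
  quotmod_pi (c *: x + y) = c *: quotmod_pi x + quotmod_pi y.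
Proof. by rewrite quotmod_piD quotmod_piZ_sub. Qed.

Lemma quotmod_piB x y : quotmod_pi (x - y) = quotmod_pi x - quotmod_pi y.
Proof. exact: raddfB. Qed.

Lemma quotmod_piZ c x : quotmod_pi (c *: x) = c *: quotmod_pi x.
Proof. exact: quotmod_piZ_sub. Qed.

End QuotientModule.

Section Presentation.
Variables (K : nzRingType) (X : choiceType).

Definition line (x : X) : lmodType K := K^o.
Definition freemod := dsum line.
HB.instance Definition _ := GRing.Lmodule.on freemod.

Definition fgen (x : X) : freemod := dinj (1 : line x).
Definition fext (W : lmodType K) (f : X -> W) : freemod -> W :=
  dlift (fun x (c : line x) => (c : K) *: f x).

Lemma fext_linear (W : lmodType K) (f : X -> W) c x y :
  fext f (c *: x + y) = c *: fext f x + fext f y.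
Proof.
by apply: dliftP => i {}c u v; rewrite scalerDl -scalerA.
Qed.

HB.instance Definition _ (W : lmodType K) (f : X -> W) :=
  GRing.isLinear.Build K freemod W *:%R (fext f) (fext_linear f).

Lemma fext_gen (W : lmodType K) (f : X -> W) x : fext f (fgen x) = f x.
Proof.
by rewrite /fext dlift_inj ?scale1r // => i c u v; rewrite scalerDl -scalerA.
Qed.

Variable R : freemod -> Prop.

Inductive span : freemod -> Prop :=
  | span0 : span 0
  | spanS c r v : R r -> span v -> span (c *: r + v).

Definition span_pred : {pred freemod} := [pred v | `[< span v >]].

Fact span_submod : subsemimod_closed span_pred.
Proof.
have D u v : span u -> span v -> span (u + v).
  by elim=> [|c r w Rr _ IH] sv; rewrite ?add0r // -addrA; apply/spanS/IH.
have Z c u : span u -> span (c *: u).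
  elim=> [|d r w Rr _ IH]; rewrite ?scaler0; first exact: span0.
  by rewrite scalerDr scalerA; apply: spanS.
split; first split.
- by apply/asboolP; apply: span0.
- by move=> u v /asboolP su /asboolP sv; apply/asboolP; apply: D.
- by move=> c u /asboolP su; apply/asboolP; apply: Z.
Qed.
HB.instance Definition _ := GRing.isSubmodClosed.Build K freemod span_pred
  span_submod.

Definition pres := quotmod span_pred.
HB.instance Definition _ := GRing.Lmodule.on pres.

Definition pgen (x : X) : pres := quotmod_pi _ (fgen x).

(* When [f] respects the relations this is the linear map sending [pgen x] to
   [f x]; see [pext_gen] and [pext_linear]. *)
Definition pext (W : lmodType K) (f : X -> W) (q : pres) : W :=
  fext f (quotmod_repr q).

Section Ext.
Variables (W : lmodType K) (f : X -> W).
Hypothesis fR : forall r, R r -> fext f r = 0.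

Lemma pext_pi x : pext f (quotmod_pi _ x) = fext f x.
Proof.
have: quotmod_repr (quotmod_pi span_pred x) - x \in span_pred.
  by apply/quotmod_eqP; rewrite quotmod_reprK.
move=> /asboolP; rewrite /pext; set y := quotmod_repr _ => s.
have: fext f (y - x) = 0.
  elim: s => [|c r v Rr _ IH]; first exact: raddf0.
  by rewrite fext_linear IH fR // scaler0 addr0.
have -> : y - x = (-1) *: x + y by rewrite scaleN1r addrC.
by rewrite fext_linear scaleN1r addrC => /subr0_eq.
Qed.

Lemma pext_gen x : pext f (pgen x) = f x.
Proof. by rewrite pext_pi fext_gen. Qed.

Lemma pext_linear c x y : pext f (c *: x + y) = c *: pext f x + pext f y.
Proof.
rewrite -[x]quotmod_reprK -[y]quotmod_reprK.
by rewrite -[c *: _ + _]quotmod_piP !pext_pi fext_linear.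
Qed.

End Ext.

Lemma pgen_rel r : R r -> quotmod_pi span_pred r = 0.
Proof.
move=> Rr; have <- : quotmod_pi span_pred 0 = 0 by exact: raddf0.
apply/quotmod_eqP; rewrite subr0; apply/asboolP.
by rewrite -[r]addr0 -[r]scale1r; apply: spanS => //; apply: span0.
Qed.

Lemma pres_ind (P : pres -> Prop) :
  (forall c x y, P x -> P y -> P (c *: x + y)) -> P 0 ->
  (forall x, P (pgen x)) -> forall q, P q.
Proof.
move=> PL P0 Pg q; rewrite -[q]quotmod_reprK.
elim/dsum_ind: (quotmod_repr q) => [c x y Px Py|x v|].
- by rewrite quotmod_piP; apply: PL.
- have -> : dinj v = (v : K) *: fgen x + 0 :> freemod.
    rewrite addr0. apply: (@dsumP K X line) => j.
    rewrite [RHS]dsumZE; have [<-|ij] := eqVneq x j.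
      by rewrite !dinj_in; apply/esym/mulr1.
    by rewrite !dinj_out // scaler0.
  rewrite quotmod_piP; apply: PL; first exact: Pg.
  by have -> : quotmod_pi span_pred 0 = 0 by exact: raddf0.
- by have -> : quotmod_pi span_pred 0 = 0 by exact: raddf0.
Qed.

End Presentation.

(* Bimodules over the [K]-algebra [A]: both actions are [K]-bilinear, so that
   the two induced [K]-module structures coincide. *)
HB.mixin Record Lmodule_isBimodule (K : fieldType) (A : algType K) M
    of GRing.Lmodule K M := {
  lact : A -> M -> M;
  ract : M -> A -> M;
  lact_linearl : forall c a b m, lact (c *: a + b) m = c *: lact a m + lact b m;
  lact_linearr : forall a c m n, lact a (c *: m + n) = c *: lact a m + lact a n;
  ract_linearl : forall c m n a, ract (c *: m + n) a = c *: ract m a + ract n a;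
  ract_linearr : forall m c a b, ract m (c *: a + b) = c *: ract m a + ract m b;
  lact1 : forall m, lact 1 m = m;
  lactA : forall a b m, lact (a * b) m = lact a (lact b m);
  ract1 : forall m, ract m 1 = m;
  ractA : forall m a b, ract m (a * b) = ract (ract m a) b;
  lractA : forall a m b, ract (lact a m) b = lact a (ract m b) }.

#[short(type="bimodType")]
HB.structure Definition Bimodule (K : fieldType) (A : algType K) :=
  { M of Lmodule_isBimodule K A M & GRing.Lmodule K M }.

Section Tensor.
Variables (K : fieldType) (U V : lmodType K).

Inductive tensor_rel : freemod K (U * V)%type -> Prop :=
  | tensor_rel_l c u u' v : tensor_rel
      (fgen K (c *: u + u', v) - c *: fgen K (u, v) - fgen K (u', v))
  | tensor_rel_r c u v v' : tensor_rel
      (fgen K (u, c *: v + v') - c *: fgen K (u, v) - fgen K (u, v')).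

Definition tensor := pres tensor_rel.
HB.instance Definition _ := GRing.Lmodule.on tensor.

Definition tens (u : U) (v : V) : tensor := pgen _ (u, v).

Lemma tensor_ext (W : lmodType K) (f : U * V -> W) :
  (forall c u u' v, f (c *: u + u', v) = c *: f (u, v) + f (u', v)) ->
  (forall c u v v', f (u, c *: v + v') = c *: f (u, v) + f (u, v')) ->
  forall r, tensor_rel r -> fext f r = 0.
Proof.
move=> fl fr r [c u u' v|c u v v']; rewrite !raddfB /= linearZ /= !fext_gen.
  by rewrite fl addrAC addrK subrr.
by rewrite fr addrAC addrK subrr.
Qed.

Lemma tens_linearl v c u u' :
  tens (c *: u + u') v = c *: tens u v + tens u' v.
Proof.
apply/subr0_eq; rewrite opprD addrA.
have := pgen_rel (tensor_rel_l c u u' v).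
by rewrite !quotmod_piB quotmod_piZ.
Qed.

Lemma tens_linearr u c v v' :
  tens u (c *: v + v') = c *: tens u v + tens u v'.
Proof.
apply/subr0_eq; rewrite opprD addrA.
have := pgen_rel (tensor_rel_r c u v v').
by rewrite !quotmod_piB quotmod_piZ.
Qed.

Lemma tensor_ind (P : tensor -> Prop) :
  (forall c x y, P x -> P y -> P (c *: x + y)) -> P 0 ->
  (forall u v, P (tens u v)) -> forall q, P q.
Proof. by move=> PL P0 Pg; apply: pres_ind => // -[u v]; apply: Pg. Qed.

End Tensor.

Section OneForms.
Variables (K : fieldType) (A : algType K).

Local Notation AA := (tensor A A).

Definition mulAA : AA -> A := pext (fun p : A * A => p.1 * p.2).
Definition lactAA (a : A) : AA -> AA := pext (fun p : A * A => tens (a * p.1) p.2).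
Definition ractAA (x : AA) (b : A) : AA :=
  pext (fun p : A * A => tens p.1 (p.2 * b)) x.

Let mulAA_rel r : tensor_rel r -> fext (fun p : A * A => p.1 * p.2) r = 0.
Proof.
apply: tensor_ext => /= *; first by rewrite mulrDl scalerAl.
by rewrite mulrDr scalerAr.
Qed.

Let lactAA_rel a r :
  tensor_rel r -> fext (fun p : A * A => tens (a * p.1) p.2) r = 0.
Proof.
apply: tensor_ext => /= *; last by rewrite tens_linearr.
by rewrite mulrDr -scalerAr tens_linearl.
Qed.

Let ractAA_rel b r :
  tensor_rel r -> fext (fun p : A * A => tens p.1 (p.2 * b)) r = 0.
Proof.
apply: tensor_ext => /= *; first by rewrite tens_linearl.
by rewrite mulrDl -scalerAl tens_linearr.
Qed.

Lemma mulAA_tens a b : mulAA (tens a b) = a * b.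
Proof. exact: (pext_gen mulAA_rel). Qed.
Lemma lactAA_tens c a b : lactAA c (tens a b) = tens (c * a) b.
Proof. exact: (pext_gen (@lactAA_rel c)). Qed.
Lemma ractAA_tens a b c : ractAA (tens a b) c = tens a (b * c).
Proof. exact: (pext_gen (@ractAA_rel c)). Qed.

Fact mulAA_linear : linear mulAA.
Proof. exact: (pext_linear mulAA_rel). Qed.
HB.instance Definition _ := GRing.isLinear.Build K AA A *:%R mulAA mulAA_linear.

Lemma lactAA_linear a : linear (lactAA a).
Proof. exact: (pext_linear (@lactAA_rel a)). Qed.
HB.instance Definition _ a :=
  GRing.isLinear.Build K AA AA *:%R (lactAA a) (lactAA_linear a).

Lemma ractAA_linear b : linear (ractAA^~ b).
Proof. exact: (pext_linear (@ractAA_rel b)). Qed.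

Lemma AA_eq (W : lmodType K) (f g : AA -> W) : linear f -> linear g ->
  (forall a b, f (tens a b) = g (tens a b)) -> f =1 g.
Proof.
move=> lf lg E; have Z h : linear h -> h (0 : AA) = 0 :> W.
  by move=> lh; have := lh (-1) 0 0; rewrite scaler0 addr0 scaleN1r addNr.
by elim/tensor_ind => [c x y ex ey||//]; rewrite ?lf ?lg ?ex ?ey ?Z.
Qed.

Lemma mulAA_lact a x : mulAA (lactAA a x) = a * mulAA x.
Proof.
move: x; apply: AA_eq => [c x y|c x y|u v].
- by rewrite lactAA_linear mulAA_linear.
- by rewrite mulAA_linear mulrDr scalerAr.
- by rewrite lactAA_tens !mulAA_tens mulrA.
Qed.

Lemma mulAA_ract x b : mulAA (ractAA x b) = mulAA x * b.
Proof.
move: x; apply: AA_eq => [c x y|c x y|u v].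
- by rewrite ractAA_linear mulAA_linear.
- by rewrite mulAA_linear mulrDl scalerAl.
- by rewrite ractAA_tens !mulAA_tens mulrA.
Qed.

Definition Omega1_pred : {pred AA} := [pred x | mulAA x == 0].

Fact Omega1_submod : subsemimod_closed Omega1_pred.
Proof.
split; first split; rewrite ?inE ?raddf0 //.
  by move=> x y; rewrite !inE raddfD /= => /eqP-> /eqP->; rewrite addr0.
by move=> c x; rewrite !inE linearZ /= => /eqP->; rewrite scaler0.
Qed.
HB.instance Definition _ :=
  GRing.isSubmodClosed.Build K AA Omega1_pred Omega1_submod.

Definition Omega1 := submodule Omega1_pred.
HB.instance Definition _ := GRing.Lmodule.on Omega1.

Fact Omega1_lact_subproof a (w : Omega1) : lactAA a (val w) \in Omega1_pred.
Proof. by rewrite inE mulAA_lact (eqP (valP w)) mulr0. Qed.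
Definition Omega1_lact a w : Omega1 := Submodule (Omega1_lact_subproof a w).

Fact Omega1_ract_subproof (w : Omega1) b : ractAA (val w) b \in Omega1_pred.
Proof. by rewrite inE mulAA_ract (eqP (valP w)) mul0r. Qed.
Definition Omega1_ract w b : Omega1 := Submodule (Omega1_ract_subproof w b).

Fact Omega1_lact_linearl c a b w :
  Omega1_lact (c *: a + b) w = c *: Omega1_lact a w + Omega1_lact b w.
Proof.
apply: val_inj => /=.
move: (submodule_val w); apply: AA_eq => [d x y|d x y|u v].
- exact: lactAA_linear.
- by rewrite !lactAA_linear !scalerDr !scalerA [c * d]mulrC addrACA.
- by rewrite !lactAA_tens mulrDl -scalerAl tens_linearl.
Qed.

Fact Omega1_lact_linearr a c w w' :
  Omega1_lact a (c *: w + w') = c *: Omega1_lact a w + Omega1_lact a w'.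
Proof.
by apply: val_inj; rewrite /= lactAA_linear.
Qed.

Fact Omega1_ract_linearl c w w' b :
  Omega1_ract (c *: w + w') b = c *: Omega1_ract w b + Omega1_ract w' b.
Proof.
by apply: val_inj; rewrite /= ractAA_linear.
Qed.

Fact Omega1_ract_linearr w c a b :
  Omega1_ract w (c *: a + b) = c *: Omega1_ract w a + Omega1_ract w b.
Proof.
apply: val_inj => /=.
move: (submodule_val w); apply: AA_eq => [d x y|d x y|u v].
- exact: ractAA_linear.
- by rewrite !ractAA_linear !scalerDr !scalerA [c * d]mulrC addrACA.
- by rewrite !ractAA_tens mulrDr -scalerAr tens_linearr.
Qed.

Fact Omega1_lact1 w : Omega1_lact 1 w = w.
Proof.
apply: val_inj => /=; move: (submodule_val w); apply: AA_eq => [d x y|//|u v].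
- exact: lactAA_linear.
- by rewrite lactAA_tens mul1r.
Qed.

Fact Omega1_lactA a b w : Omega1_lact (a * b) w = Omega1_lact a (Omega1_lact b w).
Proof.
apply: val_inj => /=; move: (submodule_val w); apply: AA_eq => [d x y|d x y|u v].
- exact: lactAA_linear.
- by rewrite !lactAA_linear.
- by rewrite !lactAA_tens mulrA.
Qed.

Fact Omega1_ract1 w : Omega1_ract w 1 = w.
Proof.
apply: val_inj => /=; move: (submodule_val w); apply: AA_eq => [d x y|//|u v].
- exact: ractAA_linear.
- by rewrite ractAA_tens mulr1.
Qed.

Fact Omega1_ractA w a b : Omega1_ract w (a * b) = Omega1_ract (Omega1_ract w a) b.
Proof.
apply: val_inj => /=; move: (submodule_val w); apply: AA_eq => [d x y|d x y|u v].
- exact: ractAA_linear.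
- by rewrite !ractAA_linear.
- by rewrite !ractAA_tens mulrA.
Qed.

Fact Omega1_lractA a w b :
  Omega1_ract (Omega1_lact a w) b = Omega1_lact a (Omega1_ract w b).
Proof.
apply: val_inj => /=; move: (submodule_val w); apply: AA_eq => [d x y|d x y|u v].
- by rewrite lactAA_linear ractAA_linear.
- by rewrite ractAA_linear lactAA_linear.
- by rewrite lactAA_tens !ractAA_tens lactAA_tens.
Qed.

HB.instance Definition _ := Lmodule_isBimodule.Build K A Omega1
  Omega1_lact_linearl Omega1_lact_linearr Omega1_ract_linearl
  Omega1_ract_linearr Omega1_lact1 Omega1_lactA Omega1_ract1 Omega1_ractA
  Omega1_lractA.

End OneForms.

Section TensorAlgebra.
Variables (K : fieldType) (A : algType K) (M : bimodType A).

(* [tpow n], for [n > 0], is the [n]-fold tensor product of [M] with itself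
   over [A]: generated by [n]-tuples, with relations expressing [K]-linearity
   in every slot and [A]-balancedness between neighbouring slots. *)
Inductive tpow_rel (n : nat) : freemod K (n.-tuple M) -> Prop :=
  | tpow_lin s1 s2 c u v (t t1 t2 : n.-tuple M) of
      val t = s1 ++ (c *: u + v) :: s2 &
      val t1 = s1 ++ u :: s2 & val t2 = s1 ++ v :: s2 :
      tpow_rel (fgen K t - c *: fgen K t1 - fgen K t2)
  | tpow_bal s1 s2 u (a : A) v (t1 t2 : n.-tuple M) of
      val t1 = s1 ++ ract u a :: v :: s2 & val t2 = s1 ++ u :: lact a v :: s2 :
      tpow_rel (fgen K t1 - fgen K t2).

Definition tpow n := pres (@tpow_rel n).
HB.instance Definition _ n := GRing.Lmodule.on (tpow n).

(* The component of degree [n]: [A] itself for [n = 0], and [tpow n] otherwise.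
   In degree [1] this is the tensor product with a single factor, which
   [m |-> pgen [tuple m]] identifies with [M]. *)
Definition tdeg (n : nat) : lmodType K :=
  if n is n'.+1 then tpow n'.+1 else A.

Definition tensor_algebra := dsum tdeg.
HB.instance Definition _ := GRing.Lmodule.on tensor_algebra.
Local Notation T := tensor_algebra.

Definition thomog n (x : tdeg n) : T := dinj x.
Definition tscalar (a : A) : T := @thomog 0 a.

(* The pure tensor [m_1 (x) ... (x) m_n], which is [1] for [n = 0]. *)
Definition tword (s : seq M) : T :=
  if s is m :: s' then @thomog (size s').+1 (pgen _ (in_tuple (m :: s')))
  else tscalar 1.

Definition lact_seq (a : A) (s : seq M) : seq M :=
  if s is m :: s' then lact a m :: s' else [::].
Definition ract_seq (s : seq M) (a : A) : seq M :=
  if s is m :: s' then rcons (belast m s') (ract (last m s') a) else [::].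

(* Products of homogeneous elements: the product of [A], the actions of [A] on
   the outer tensor factors, and concatenation of tensors. *)
Definition tmul_homog (k l : nat) : tdeg k -> tdeg l -> T :=
  match k, l return tdeg k -> tdeg l -> T with
  | 0, 0 => fun a b => tscalar (a * b)
  | 0, l'.+1 => fun a =>
      pext (fun t : l'.+1.-tuple M => tword (lact_seq a t))
  | k'.+1, 0 => fun x b =>
      pext (fun s : k'.+1.-tuple M => tword (ract_seq s b)) x
  | k'.+1, l'.+1 => fun x y =>
      pext (fun s : k'.+1.-tuple M =>
        pext (fun t : l'.+1.-tuple M => tword (s ++ t)) y) x
  end.

Definition tmul (x y : T) : T :=
  dlift (fun k (xk : tdeg k) =>
    dlift (fun l (yl : tdeg l) => tmul_homog xk yl) y) x.

Lemma thomogP n c (x y : tdeg n) :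
  thomog (c *: x + y) = c *: thomog x + thomog y.
Proof. exact: dinjP. Qed.

Lemma tword_tuple n (t : n.+1.-tuple M) :
  tword t = @thomog n.+1 (pgen _ t).
Proof.
case: t => [[|m s] //= ht]; have /eqP[e] := ht.
by case: n / e ht => ht; congr (thomog _); congr (pgen _ _); apply: val_inj.
Qed.

Lemma tword_lin s1 s2 c u v :
  tword (s1 ++ (c *: u + v) :: s2) =
  c *: tword (s1 ++ u :: s2) + tword (s1 ++ v :: s2).
Proof.
have sz w : size (s1 ++ w :: s2) == (size s1 + size s2).+1.
  by rewrite size_cat addnS.
rewrite (tword_tuple (Tuple (sz (c *: u + v)))) (tword_tuple (Tuple (sz u))).
rewrite (tword_tuple (Tuple (sz v))) -thomogP; congr (thomog _).
apply/subr0_eq; rewrite opprD addrA.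
pose t w := Tuple (sz w).
have := pgen_rel (@tpow_lin _ s1 s2 c u v (t _) (t _) (t _) erefl erefl erefl).
by rewrite !quotmod_piB quotmod_piZ.
Qed.

Lemma tword_bal s1 s2 u a v :
  tword (s1 ++ ract u a :: v :: s2) = tword (s1 ++ u :: lact a v :: s2).
Proof.
have sz w w' : size (s1 ++ w :: w' :: s2) == (size s1 + size s2).+2.
  by rewrite size_cat !addnS.
rewrite (tword_tuple (Tuple (sz (ract u a) v))).
rewrite (tword_tuple (Tuple (sz u (lact a v)))); congr (thomog _).
apply/subr0_eq; pose t w w' := Tuple (sz w w').
have := pgen_rel (@tpow_bal _ s1 s2 u a v (t _ _) (t _ _) erefl erefl).
by rewrite !quotmod_piB.
Qed.

Definition multibal (W : lmodType K) (f : seq M -> W) : Prop :=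
  (forall s1 s2 c u v, f (s1 ++ (c *: u + v) :: s2) =
     c *: f (s1 ++ u :: s2) + f (s1 ++ v :: s2)) /\
  (forall s1 s2 u a v,
     f (s1 ++ ract u a :: v :: s2) = f (s1 ++ u :: lact a v :: s2)).

Lemma tpow_ext (W : lmodType K) (f : seq M -> W) n : multibal f ->
  forall r, @tpow_rel n r -> fext (fun t : n.-tuple M => f t) r = 0.
Proof.
move=> [fl fb] r [s1 s2 c u v t t1 t2 e e1 e2|s1 s2 u a v t1 t2 e1 e2].
  rewrite !raddfB /= linearZ /= !fext_gen.
  by move: e e1 e2; rewrite /= => -> -> ->; rewrite fl addrAC addrK subrr.
rewrite raddfB /= !fext_gen.
by move: e1 e2; rewrite /= => -> ->; rewrite fb subrr.
Qed.

Lemma tensor_algebra_ind (P : T -> Prop) :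
  (forall c x y, P x -> P y -> P (c *: x + y)) ->
  (forall a, P (tscalar a)) -> (forall s, s != [::] -> P (tword s)) ->
  forall x, P x.
Proof.
move=> PL PA PT; have h0 n : thomog (0 : tdeg n) = 0.
  have := thomogP (-1) (0 : tdeg n) 0.
  by rewrite scaler0 addr0 scaleN1r addNr.
have P0 : P 0 by rewrite -(h0 0); apply: PA.
elim/dsum_ind => // [[|n]] v; first exact: PA.
elim/pres_ind: v => [c x y Px Py||t]; first by rewrite dinjP; apply: PL.
  by rewrite [dinj _]h0.
by rewrite -[dinj _]tword_tuple; apply: PT; rewrite -size_eq0 size_tuple.
Qed.

Lemma multibal_tword : multibal tword.
Proof. by split; [apply: tword_lin | apply: tword_bal]. Qed.

Lemma multibal_catl s : multibal (fun t => tword (s ++ t)).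
Proof.
by split=> *; rewrite !catA; [apply: tword_lin | apply: tword_bal].
Qed.

Lemma multibal_catr t : multibal (fun s => tword (s ++ t)).
Proof.
by split=> *; rewrite -!catA; [apply: tword_lin | apply: tword_bal].
Qed.

Lemma multibal_lact a : multibal (fun s => tword (lact_seq a s)).
Proof.
split=> [[|m s1] s2 c u v|[|m s1] s2 u b v] /=.
- by rewrite lact_linearr; apply: (tword_lin [::]).
- exact: (tword_lin (_ :: _)).
- by rewrite -lractA; apply: (tword_bal [::]).
- exact: (tword_bal (_ :: _)).
Qed.

Lemma ract_seq_rcons s m a : ract_seq (rcons s m) a = rcons s (ract m a).
Proof. by case: s => //= n s; rewrite belast_rcons last_rcons. Qed.

Lemma ract_seq_cat s t a : t != [::] -> ract_seq (s ++ t) a = s ++ ract_seq t a.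
Proof.
by case/lastP: t => // t m _; rewrite -rcons_cat !ract_seq_rcons rcons_cat.
Qed.

Lemma multibal_ract a : multibal (fun s => tword (ract_seq s a)).
Proof.
split=> [s1 s2 c u v|s1 s2 u b v]; rewrite !ract_seq_cat //.
  case: s2 => [|n s2] /=; last exact: tword_lin.
  by rewrite ract_linearl; apply: tword_lin.
case: s2 => [|n s2] /=; last exact: tword_bal.
by rewrite lractA; apply: tword_bal.
Qed.

Let ext_linear (W : lmodType K) (f : seq M -> W) n c (x y : tpow n) :
  multibal f -> let F := fun t : n.-tuple M => f t in
  pext F (c *: x + y) = c *: pext F x + pext F y.
Proof. by move=> fm F; apply: (pext_linear (tpow_ext fm)). Qed.

Let ext_gen (W : lmodType K) (f : seq M -> W) n (t : n.-tuple M) :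
  multibal f -> pext (fun t : n.-tuple M => f t) (pgen (@tpow_rel n) t) = f t.
Proof. by move=> fm; apply: (pext_gen (tpow_ext fm)). Qed.

Let ext_eq (W : lmodType K) (f g h : seq M -> W) n c (x : tpow n) :
  multibal f -> multibal g -> multibal h ->
  (forall t : n.-tuple M, f t = c *: g t + h t) ->
  pext (fun t : n.-tuple M => f t) x =
  c *: pext (fun t : n.-tuple M => g t) x + pext (fun t : n.-tuple M => h t) x.
Proof.
move=> fm gm hm E; have Z (k : seq M -> W) : multibal k ->
    pext (fun t : n.-tuple M => k t) (0 : tpow n) = 0.
  move=> km; have := ext_linear (-1) (0 : tpow n) 0 km.
  by rewrite /= scaler0 addr0 scaleN1r addNr.
elim/pres_ind: x => [d x y ex ey||t]; last by rewrite !ext_gen.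
  rewrite !ext_linear // ex ey !scalerDr !scalerA [c * d]mulrC.
  by rewrite addrACA.
by rewrite !Z // scaler0 addr0.
Qed.

Lemma multibal_cat n (y : tpow n) :
  multibal (fun s => pext (fun t : n.-tuple M => tword (s ++ t)) y).
Proof.
split=> [s1 s2 c u v|s1 s2 u a v].
  apply: (ext_eq (f := fun t => tword (_ ++ t)) (g := fun t => tword (_ ++ t))
    (h := fun t => tword (_ ++ t))) => [|||t]; try exact: multibal_catl.
  by rewrite -!catA; apply: tword_lin.
have := @ext_eq _ (fun t => tword ((s1 ++ ract u a :: v :: s2) ++ t))
  (fun t => tword ((s1 ++ u :: lact a v :: s2) ++ t)) (fun=> 0) n 1 y.
rewrite scale1r => ->; try exact: multibal_catl.
- rewrite -[RHS]addr0; congr (_ + _).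
  have m0 : multibal (fun _ : seq M => 0 : T).
    by split=> *; rewrite ?scaler0 ?addr0.
  elim/pres_ind: y => [c x y ex ey||t]; last by rewrite (ext_gen _ m0).
    by rewrite (ext_linear _ _ _ m0) ex ey scaler0 addr0.
  have := ext_linear (-1) (0 : tpow n) 0 m0.
  by rewrite /= scaler0 addr0 scaleN1r addNr.
- by split=> *; rewrite ?scaler0 ?addr0.
- by move=> t; rewrite scale1r addr0 -!catA; apply: tword_bal.
Qed.

Lemma tmul_homog_linearl k l c (x x' : tdeg k) (y : tdeg l) :
  tmul_homog (c *: x + x') y = c *: tmul_homog x y + tmul_homog x' y.
Proof.
case: k l x x' y => [|k] [|l] x x' y /=.
- by rewrite mulrDl -scalerAl; apply: (@thomogP 0).
- pose f a := fun t => tword (lact_seq a t).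
  apply: (@ext_eq T (f (c *: x + x')) (f x) (f x')) => [|||[[|m t] //= _]];
    try exact: multibal_lact.
  by rewrite /f /= lact_linearl; apply: (tword_lin [::]).
- exact: (ext_linear _ _ _ (multibal_ract _)).
- exact: (ext_linear _ _ _ (multibal_cat _)).
Qed.

Lemma tmul_homog_linearr k l c (x : tdeg k) (y y' : tdeg l) :
  tmul_homog x (c *: y + y') = c *: tmul_homog x y + tmul_homog x y'.
Proof.
case: k l x y y' => [|k] [|l] x y y' /=.
- by rewrite mulrDr -scalerAr; apply: (@thomogP 0).
- exact: (ext_linear _ _ _ (multibal_lact _)).
- pose f a := fun t => tword (ract_seq t a).
  apply: (@ext_eq T (f (c *: y + y')) (f y) (f y')) => [|||[t /= ht]];
    try exact: multibal_ract.
  case/lastP: t ht => // t m _; rewrite /f !ract_seq_rcons ract_linearr -!cats1.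
  exact: tword_lin.
- pose f (z : tpow l.+1) s := pext (fun t : l.+1.-tuple M => tword (s ++ t)) z.
  apply: (@ext_eq T (f (c *: y + y')) (f y) (f y') k.+1 c x) => [|||s];
    try exact: multibal_cat.
  exact: (ext_linear _ _ _ (multibal_catl _)).
Qed.

Lemma tmul_linearl c x x' y :
  tmul (c *: x + x') y = c *: tmul x y + tmul x' y.
Proof.
apply: dliftP => i {}c u v; rewrite /dlift scaler_sumr -big_split /=.
by apply: eq_bigr => j _; rewrite tmul_homog_linearl.
Qed.

Lemma tmul_linearr c x y y' :
  tmul x (c *: y + y') = c *: tmul x y + tmul x y'.
Proof.
rewrite /tmul [LHS]/dlift scaler_sumr -big_split /=.
apply: eq_bigr => j _; rewrite (@dliftP _ _ _ _ (@tmul_homog j^~ (x j))) //.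
by move=> i {}c u v; rewrite tmul_homog_linearr.
Qed.

Lemma tmul_thomog k l (x : tdeg k) (y : tdeg l) :
  tmul (thomog x) (thomog y) = tmul_homog x y.
Proof.
rewrite /tmul dlift_inj => [|i c u v].
  by rewrite dlift_inj // => i c u v; rewrite tmul_homog_linearr.
rewrite /dlift scaler_sumr -big_split /=.
by apply: eq_bigr => j _; rewrite tmul_homog_linearl.
Qed.

Lemma tmul_scalar a b : tmul (tscalar a) (tscalar b) = tscalar (a * b).
Proof. exact: tmul_thomog. Qed.

Lemma tmul_scalar_word a s : s != [::] ->
  tmul (tscalar a) (tword s) = tword (lact_seq a s).
Proof.
case: s => // m s _; rewrite [tmul _ _]tmul_thomog.
exact: (ext_gen _ (multibal_lact a)).
Qed.

Lemma tmul_word_scalar a s : s != [::] ->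
  tmul (tword s) (tscalar a) = tword (ract_seq s a).
Proof.
case: s => // m s _; rewrite [tmul _ _]tmul_thomog.
exact: (ext_gen _ (multibal_ract a)).
Qed.

Lemma tmul_word s t : tmul (tword s) (tword t) = tword (s ++ t).
Proof.
case: s t => [|m s] [|n t]; first by rewrite [LHS]tmul_scalar mulr1.
- by rewrite [LHS]tmul_scalar_word //= lact1.
- by rewrite [LHS]tmul_word_scalar // cats0 lastI ract_seq_rcons ract1.
rewrite [LHS]tmul_thomog [LHS](ext_gen _ (multibal_cat _)).
exact: (ext_gen _ (multibal_catl _)).
Qed.

Fact tmul0l y : tmul 0 y = 0.
Proof.
by have := tmul_linearl (-1) 0 0 y; rewrite scaler0 addr0 scaleN1r addNr.
Qed.

Fact tmul0r x : tmul x 0 = 0.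
Proof.
by have := tmul_linearr (-1) x 0 0; rewrite scaler0 addr0 scaleN1r addNr.
Qed.

Let lact_neq0 a s : s != [::] -> lact_seq a s != [::].
Proof. by case: s. Qed.
Let ract_neq0 a s : s != [::] -> ract_seq s a != [::].
Proof. by case: s => //= m s _; rewrite -size_eq0 size_rcons. Qed.
Let cat_neq0 (s t : seq M) : s != [::] -> s ++ t != [::].
Proof. by case: s. Qed.

Fact tmulA : associative tmul.
Proof.
move=> x y z.
elim/tensor_algebra_ind: x => [c x x' ex ex'|a|s s0].
- by rewrite !tmul_linearl ex ex'.
- elim/tensor_algebra_ind: y => [c y y' ey ey'|b|t t0].
  + by rewrite !(tmul_linearl, tmul_linearr) ey ey'.
  + elim/tensor_algebra_ind: z => [c z z' ez ez'|d|u u0].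
    * by rewrite !tmul_linearr ez ez'.
    * by rewrite !tmul_scalar mulrA.
    * rewrite tmul_scalar !tmul_scalar_word ?lact_neq0 //.
      by case: u u0 => //= m u _; rewrite lactA.
  + elim/tensor_algebra_ind: z => [c z z' ez ez'|d|u u0].
    * by rewrite !tmul_linearr ez ez'.
    * rewrite tmul_word_scalar // !tmul_scalar_word ?ract_neq0 //.
      rewrite tmul_word_scalar ?lact_neq0 //; congr (tword _).
      by case: t t0 => //= m [|n t] _ //=; rewrite lractA.
    * rewrite tmul_word !tmul_scalar_word ?cat_neq0 // tmul_word.
      by case: t t0.
- elim/tensor_algebra_ind: y => [c y y' ey ey'|b|t t0].
  + by rewrite !(tmul_linearl, tmul_linearr) ey ey'.
  + elim/tensor_algebra_ind: z => [c z z' ez ez'|d|u u0].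
    * by rewrite !tmul_linearr ez ez'.
    * rewrite tmul_scalar !tmul_word_scalar ?ract_neq0 //.
      by case/lastP: s s0 => // s m _; rewrite !ract_seq_rcons ractA.
    * rewrite tmul_scalar_word // tmul_word_scalar // !tmul_word.
      case/lastP: s s0 => // s m _; case: u u0 => // n u _.
      by rewrite ract_seq_rcons -!cats1 -!catA /= tword_bal.
  + elim/tensor_algebra_ind: z => [c z z' ez ez'|d|u u0].
    * by rewrite !tmul_linearr ez ez'.
    * rewrite tmul_word !tmul_word_scalar ?cat_neq0 // tmul_word.
      by rewrite ract_seq_cat.
    * by rewrite !tmul_word catA.
Qed.

Fact tmul1l : left_id (tscalar 1) tmul.
Proof.
elim/tensor_algebra_ind => [c x y ex ey|a|s s0].
- by rewrite tmul_linearr ex ey.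
- by rewrite tmul_scalar mul1r.
- by rewrite (tmul_word [::]).
Qed.

Fact tmul1r : right_id (tscalar 1) tmul.
Proof.
elim/tensor_algebra_ind => [c x y ex ey|a|s s0].
- by rewrite tmul_linearl ex ey.
- by rewrite tmul_scalar mulr1.
- by rewrite (tmul_word _ [::]) cats0.
Qed.

Fact tmulDl : left_distributive tmul +%R.
Proof. by move=> x y z; have := tmul_linearl 1 x y z; rewrite !scale1r. Qed.
Fact tmulDr : right_distributive tmul +%R.
Proof. by move=> x y z; have := tmul_linearr 1 x y z; rewrite !scale1r. Qed.

Fact tscalar1_neq0 : tscalar 1 != 0.
Proof.
apply/eqP => /(congr1 (fun x : T => x 0)); rewrite /tscalar /thomog dinj_in.
exact/eqP/oner_neq0.
Qed.

HB.instance Definition _ := GRing.Zmodule_isNzRing.Build T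
  tmulA tmul1l tmul1r tmulDl tmulDr tscalar1_neq0.

Fact tmulZl c (x y : T) : c *: (x * y) = (c *: x) * y.
Proof.
by have := tmul_linearl c x 0 y; rewrite addr0 tmul0l addr0 => /esym.
Qed.
Fact tmulZr c (x y : T) : c *: (x * y) = x * (c *: y).
Proof.
by have := tmul_linearr c x y 0; rewrite addr0 tmul0r addr0 => /esym.
Qed.
HB.instance Definition _ := GRing.Lmodule_isLalgebra.Build K T tmulZl.
HB.instance Definition _ := GRing.Lalgebra_isAlgebra.Build K T tmulZr.

Let lactT (a : A) (x : T) : T := tscalar a * x.
Let ractT (x : T) (a : A) : T := x * tscalar a.

Fact lactT_linearl c a b x :
  lactT (c *: a + b) x = c *: lactT a x + lactT b x.
Proof. by rewrite /lactT /tscalar (@thomogP 0) mulrDl scalerAl. Qed.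
Fact lactT_linearr a c x y : lactT a (c *: x + y) = c *: lactT a x + lactT a y.
Proof. by rewrite /lactT mulrDr scalerAr. Qed.
Fact ractT_linearl c x y a : ractT (c *: x + y) a = c *: ractT x a + ractT y a.
Proof. by rewrite /ractT mulrDl scalerAl. Qed.
Fact ractT_linearr x c a b :
  ractT x (c *: a + b) = c *: ractT x a + ractT x b.
Proof. by rewrite /ractT /tscalar (@thomogP 0) mulrDr scalerAr. Qed.
Fact lactT1 x : lactT 1 x = x.
Proof. exact: mul1r. Qed.
Fact lactTA a b x : lactT (a * b) x = lactT a (lactT b x).
Proof. by rewrite /lactT mulrA; congr (_ * _); rewrite [RHS]tmul_scalar. Qed.
Fact ractT1 x : ractT x 1 = x.
Proof. exact: mulr1. Qed.
Fact ractTA x a b : ractT x (a * b) = ractT (ractT x a) b.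
Proof. by rewrite /ractT -mulrA; congr (_ * _); rewrite [RHS]tmul_scalar. Qed.
Fact lractTA a x b : ractT (lactT a x) b = lactT a (ractT x b).
Proof. by rewrite /lactT /ractT mulrA. Qed.
HB.instance Definition _ := Lmodule_isBimodule.Build K A T lactT_linearl
  lactT_linearr ractT_linearl ractT_linearr lactT1 lactTA ractT1 ractTA lractTA.

Lemma tensor_lactE a (x : T) : lact a x = tscalar a * x. Proof. by []. Qed.
Lemma tensor_ractE (x : T) (a : A) : ract x a = x * tscalar a.
Proof. by []. Qed.

Lemma tword_cat s t : tword (s ++ t) = tword s * tword t.
Proof. by rewrite [RHS]tmul_word. Qed.

Lemma tword_prod s : tword s = \prod_(m <- s) tword [:: m].
Proof.
elim: s => [|m s IHs]; first by rewrite big_nil.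
by rewrite big_cons -IHs -tword_cat.
Qed.

End TensorAlgebra.

Section Forms.
Variables (K : fieldType) (A : algType K).

Definition Omega := tensor_algebra (Omega1 A).
HB.instance Definition _ := GRing.Algebra.on Omega.
HB.instance Definition _ := Bimodule.on Omega.

(* [homogeneous k x] means that [x] lies in the summand of degree [k] of
   [Omega], which is [0] when [k < 0]. *)
Definition homogeneous (k : int) (x : Omega) : Prop :=
  forall i : nat, i%:Z != k -> dsum_val x i = 0.

Lemma homogeneous_lin k c x y :
  homogeneous k x -> homogeneous k y -> homogeneous k (c *: x + y).
Proof.
move=> hx hy i ik; rewrite [LHS]dsumDE dsumZE.
by rewrite [dsum_val x i]hx // [dsum_val y i]hy // scaler0 addr0.
Qed.

Lemma homogeneous0 k : homogeneous k 0. Proof. by []. Qed.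

Fact subsemimod_closed_lin (V : lmodType K) (P : V -> Prop) :
  P 0 -> (forall c u v, P u -> P v -> P (c *: u + v)) ->
  subsemimod_closed [pred v : V | `[< P v >]].
Proof.
move=> P0 PL; split; first split.
- exact/asboolP.
- move=> u v /asboolP Pu /asboolP Pv; apply/asboolP.
  by rewrite -[u]scale1r; apply: PL.
- move=> c u /asboolP Pu; apply/asboolP.
  by rewrite -[c *: u]addr0; apply: PL.
Qed.

(* Homomorphisms of [A]-bimodules from [Omega1] to the degree [k] summand of
   [Omega]. *)
Definition is_hom1 (k : int) (X : Omega1 A -> Omega) : Prop :=
  [/\ linear X,
      forall a w, X (lact a w) = lact a (X w),
      forall w (a : A), X (ract w a) = ract (X w) a
    & forall w, homogeneous k (X w)].

Definition hom1_pred k : {pred Omega1 A -> Omega} :=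
  [pred X | `[< is_hom1 k X >]].

Fact hom1_submod k : subsemimod_closed (hom1_pred k).
Proof.
apply: subsemimod_closed_lin.
  split=> [c u v|a w|w a|w] //; first by rewrite scaler0 addr0.
    by rewrite tensor_lactE mulr0.
  by rewrite tensor_ractE mul0r.
move=> c X Y [Xl Xa Xb Xh] [Yl Ya Yb Yh]; split=> [d u v|a w|w a|w] /=.
- rewrite !fctE Xl Yl !scalerDr !scalerA [c * d]mulrC.
  by rewrite addrACA.
- by rewrite !fctE Xa Ya lact_linearr.
- by rewrite !fctE Xb Yb ract_linearl.
- exact: homogeneous_lin.
Qed.
HB.instance Definition _ k :=
  GRing.isSubmodClosed.Build K _ (hom1_pred k) (hom1_submod k).

Definition hom1 (k : int) : lmodType K := submodule (hom1_pred k).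
Definition hom1_fun k (X : hom1 k) : Omega1 A -> Omega := submodule_val X.

(* The direct sum ranges over [k >= 0] only. *)
Definition hom1_nat (k : nat) : lmodType K := hom1 k%:Z.
Definition hom1_star := dsum hom1_nat.
HB.instance Definition _ := GRing.Lmodule.on hom1_star.

Definition graded_derivation (k : int) (D : Omega -> Omega) : Prop :=
  [/\ linear D,
      forall (l : nat) x, homogeneous l%:Z x -> homogeneous (k + l%:Z) (D x)
    & forall (l : nat) x y, homogeneous l%:Z x ->
        D (x * y) = D x * y + (-1 : K) ^ (k * l%:Z) *: (x * D y)].

Definition algebraic (D : Omega -> Omega) : Prop :=
  forall x, homogeneous 0 x -> D x = 0.

Definition is_algder k D := graded_derivation k D /\ algebraic D.

Definition algder_pred k : {pred Omega -> Omega} :=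
  [pred D | `[< is_algder k D >]].

Fact algder_submod k : subsemimod_closed (algder_pred k).
Proof.
apply: subsemimod_closed_lin.
  split=> //; split=> [c u v|//|l x y _]; first by rewrite scaler0 addr0.
  by rewrite mul0r mulr0 scaler0 addr0.
move=> c D E [[Dl Dh DM] Da] [[El Eh EM] Ea]; split; last first.
  by move=> x x0; rewrite !fctE Da // Ea // scaler0 addr0.
split=> [d u v|l x xl|l x y xl] /=.
- rewrite !fctE Dl El !scalerDr !scalerA [c * d]mulrC.
  by rewrite addrACA.
- by apply: homogeneous_lin; [apply: Dh | apply: Eh].
- rewrite !fctE (DM l) // (EM l) // mulrDl mulrDr !scalerDr !scalerA.
  by rewrite scalerAl -scalerAr scalerA [c * _]mulrC addrACA.
Qed.
HB.instance Definition _ k :=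
  GRing.isSubmodClosed.Build K _ (algder_pred k) (algder_submod k).

Definition algder (k : int) : lmodType K := submodule (algder_pred k).
Definition algder_fun k (D : algder k) : Omega -> Omega := submodule_val D.

Definition algder_star := dsum algder.
HB.instance Definition _ := GRing.Lmodule.on algder_star.

(* [D] satisfies the formula defining the map attached to [X]; the product of
   [Omega] is the tensor product over [A], and [tword] of the empty sequence is
   its unit. *)
Definition j_formula (k : int) (X : Omega1 A -> Omega) (D : Omega -> Omega) :=
  (forall x, homogeneous 0 x -> D x = 0) /\
  forall (l : nat) (w : l.+1.-tuple (Omega1 A)),
    D (tword w) = \sum_(i < l.+1) (-1 : K) ^ (i%:Z * k) *:
      (tword (take i w) * X (tnth w i) * tword (drop i.+1 w)).

End Forms.

(* Main.v *)
Require Import Defs.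
From HB Require Import structures.
From mathcomp Require Import all_boot all_order all_algebra.
From mathcomp Require Import boolp functions.

Import GRing.Theory Num.Theory.
Local Open Scope ring_scope.

(** The alternating sum [j_X] satisfies the recursion
    [j_X (m (x) s) = X m (x) s + (-1)^k m (x) j_X s] on pure tensors. Read as a
    definition, this is multilinear and [A]-balanced because [X] is a bimodule
    map, so it descends to [Omega], and iterating it gives the graded Leibniz
    rule on concatenations of pure tensors. Conversely, an algebraic derivation
    [D] is [A]-bilinear, hence restricts to a bimodule map on one-forms, and
    the Leibniz rule turns into the recursion above, so [D] is [j] of its
    restriction. In degrees below [-1] that restriction takes its values in
    negative degree, so [D = 0]; this makes the nonnegative summands of
    [hom1_star] exhaust [algder_star]. *)

Section Insertion.
Set Implicit Arguments.
Unset Strict Implicit.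
Unset Printing Implicit Defensive.
Import Order.TTheory.
Local Arguments tword : simpl never.
Variables (K : fieldType) (A : algType K).
Local Notation Om := (Omega A).
Local Notation Om1 := (Omega1 A).
Local Notation sc a := (tscalar (Omega1 A) a : Omega A).
Local Notation tw s := (tword (M := Omega1 A) s : Omega A).
Implicit Types (x y : Om) (s t : seq Om1) (a b : A) (k : int).

(** * Products of scalars and pure tensors *)

Lemma Omega_lactE a x : lact a x = sc a * x. Proof. by []. Qed.
Lemma Omega_ractE x a : ract x a = x * sc a. Proof. by []. Qed.

Lemma Omega_scalerC (c d : K) x : c *: (d *: x) = d *: (c *: x).
Proof. by rewrite !scalerA mulrC. Qed.

Lemma Omega_scalarM a b : sc a * sc b = sc (a * b).
Proof. exact: tmul_scalar. Qed.

Lemma Omega_wordM s t : tw s * tw t = tw (s ++ t).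
Proof. exact: tmul_word. Qed.

Lemma Omega_scalar_word a s : s != [::] -> sc a * tw s = tw (lact_seq a s).
Proof. exact: tmul_scalar_word. Qed.

Lemma Omega_word_scalar s a : s != [::] -> tw s * sc a = tw (ract_seq s a).
Proof. exact: tmul_word_scalar. Qed.

Lemma tword_cons m s : tw (m :: s) = tw [:: m] * tw s.
Proof. by rewrite Omega_wordM. Qed.

Lemma tword1_linear : linear (fun m : Om1 => tw [:: m]).
Proof. by move=> c u v; apply: (tword_lin [::] [::]). Qed.

(** * The grading of [Omega] *)

Lemma homogeneous_thomog (n : nat) (v : tdeg Om1 n) :
  homogeneous n%:Z (thomog v : Om).
Proof. by move=> i ni; apply: dinj_out; rewrite eq_sym. Qed.

Lemma homogeneous_scalar a : homogeneous 0 (sc a).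
Proof. exact: (@homogeneous_thomog 0). Qed.

Lemma homogeneous_word s : homogeneous (size s)%:Z (tw s).
Proof.
case: s => [|m s]; first exact: homogeneous_scalar.
exact: (@homogeneous_thomog (size s).+1).
Qed.

(** Components are indexed by natural numbers, so a negative [k] leaves none that may be nonzero. *)
Lemma homogeneous_neg k x : k < 0 -> homogeneous k x -> x = 0.
Proof.
move=> k0 hx; apply: dsumP => i; apply: hx.
by apply: contraTneq k0 => <-.
Qed.

Lemma homogeneous_nat (l : nat) x :
  homogeneous l%:Z x -> x = thomog (dsum_val x l).
Proof.
move=> hx; apply: dsumP => i; rewrite /thomog.
have [<-|li] := eqVneq l i; first by rewrite dinj_in.
by rewrite dinj_out // hx // eqz_nat eq_sym.
Qed.

(** Lets linear statements in degree [l] be checked on words of length [l], and on scalars only when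
    [l] is zero. *)
Lemma homogeneous_ind (P : Om -> Prop) (l : nat) :
  (forall c x y, P x -> P y -> P (c *: x + y)) ->
  (l = 0 -> forall a, P (sc a)) ->
  (forall s, s != [::] -> size s = l -> P (tw s)) ->
  forall x, homogeneous l%:Z x -> P x.
Proof.
move=> PL Psc Pw x /homogeneous_nat ->; move: (dsum_val x l) => {x} v.
case: l v Psc Pw => [|l] v Psc Pw; first exact: Psc.
(* Zero is a word of length [l.+1] minus itself, so closure under linear combinations covers it. *)
have P0 : P 0.
  pose s := nseq l.+1 (0 : Om1).
  have Ps : P (tw s) by apply: Pw => //; rewrite size_nseq.
  by have := PL (-1) _ _ Ps Ps; rewrite scaleN1r addNr.
elim/pres_ind: v => [c x y Px Py||t].
- by rewrite thomogP; apply: PL.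
- rewrite (_ : thomog _ = 0) //; apply: dsumP => i; rewrite /thomog.
  have [<-|li] := eqVneq l.+1 i; first by rewrite dinj_in.
  by rewrite dinj_out.
- rewrite -tword_tuple; apply: Pw; last by rewrite size_tuple.
  by rewrite -size_eq0 size_tuple.
Qed.

(** A negative degree forces a factor to be zero. Otherwise bilinearity reduces to scalars and
    words, whose lengths add under concatenation and are kept by scalar actions. *)
Lemma homogeneousM (k l : int) x y :
  homogeneous k x -> homogeneous l y -> homogeneous (k + l) (x * y).
Proof.
move=> hx hy.
have [k0|k0] := ltP k 0.
  by rewrite (homogeneous_neg k0 hx) mul0r; apply: homogeneous0.
have [l0|l0] := ltP l 0.
  by rewrite (homogeneous_neg l0 hy) mulr0; apply: homogeneous0.
case: k hx k0 => // k hx _; case: l hy l0 => // l hy _.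
rewrite -PoszD; move: x hx.
have sza a s : size (lact_seq a s) = size s by case: s.
have szr a s : size (ract_seq s a) = size s.
  by case/lastP: s => // s m; rewrite ract_seq_rcons !size_rcons.
apply: homogeneous_ind => [c x x' hx hx'|k0 a|s s0 sk].
- by rewrite mulrDl -scalerAl; apply: homogeneous_lin.
- rewrite k0; move: y hy.
  apply: homogeneous_ind => [c y y' hy hy'|l0 b|t t0 tl].
  + by rewrite mulrDr -scalerAr; apply: homogeneous_lin.
  + by rewrite l0 Omega_scalarM; apply: homogeneous_scalar.
  + by rewrite Omega_scalar_word // -tl -(sza a); apply: homogeneous_word.
- move: y hy; apply: homogeneous_ind => [c y y' hy hy'|l0 b|t t0 tl].
  + by rewrite mulrDr -scalerAr; apply: homogeneous_lin.
  + rewrite l0 addn0 Omega_word_scalar // -sk -(szr b).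
    exact: homogeneous_word.
  + by rewrite Omega_wordM -sk -tl -size_cat; apply: homogeneous_word.
Qed.

(** * Extending balanced multilinear maps from words to [Omega] *)

Definition word_ext (f : seq Om1 -> Om) : Om -> Om :=
  dlift (fun n => match n return tdeg Om1 n -> Om with
    | 0 => fun=> 0
    | n'.+1 => pext (fun t : n'.+1.-tuple Om1 => f t)
    end).

Section WordExt.
Variable f : seq Om1 -> Om.
Hypothesis fm : multibal f.

Let comp_linear n c (u v : tdeg Om1 n) :
  let F := match n return tdeg Om1 n -> Om with
    | 0 => fun=> 0
    | n'.+1 => pext (fun t : n'.+1.-tuple Om1 => f t)
    end in F (c *: u + v) = c *: F u + F v.
Proof.
case: n u v => [|n] u v /=; first by rewrite scaler0 addr0.
exact: (pext_linear (tpow_ext fm)).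
Qed.

Lemma word_ext_linear : linear (word_ext f).
Proof. by move=> c x y; apply: dliftP => i {}c u v; apply: comp_linear. Qed.

(** This vanishing in degree zero is what makes maps built by [word_ext] algebraic. *)
Lemma word_ext_scalar a : word_ext f (sc a) = 0.
Proof. by rewrite /word_ext dlift_inj // => i c u v; apply: comp_linear. Qed.

Lemma word_ext_word s : s != [::] -> word_ext f (tw s) = f s.
Proof.
case: s => // m s _; rewrite /word_ext dlift_inj.
  exact: (pext_gen (tpow_ext fm)).
by move=> i c u v; apply: comp_linear.
Qed.

End WordExt.

Lemma Omega_eq (D E : Om -> Om) : linear D -> linear E ->
  (forall a, D (sc a) = E (sc a)) ->
  (forall s, s != [::] -> D (tw s) = E (tw s)) -> D = E.
Proof.
move=> Dl El Ea Es; apply: funext; apply: tensor_algebra_ind => //.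
by move=> c x y ex ey; rewrite Dl El ex ey.
Qed.

(** * The alternating sum on words *)

Variables (k : int) (X : Om1 -> Om).

Fixpoint insertion s : Om :=
  if s is m :: s' then X m * tw s' + (-1 : K) ^ k *: (tw [:: m] * insertion s')
  else 0.

(** This is the graded Leibniz rule on words: moving past each letter of [s] costs a factor
    [(-1) ^ k]. *)
Lemma insertion_cat s t : insertion (s ++ t) =
  insertion s * tw t + (-1 : K) ^ (k * (size s)%:Z) *: (tw s * insertion t).
Proof.
elim: s => [|m s IHs] /=; first by rewrite mul0r add0r mulr0 scale1r mul1r.
rewrite IHs -Omega_wordM (tword_cons m s) mulrDl !mulrDr scalerDr !mulrA addrA.
rewrite -!scalerAl -!scalerAr scalerA !mulrA; congr (_ + _ *: _).
by rewrite -expfzDr ?oppr_eq0 ?oner_eq0 // intS mulrDr mulr1.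
Qed.

(** Each letter peeled off by the recursion contributes [(-1) ^ k], so position [i] collects
    [(-1) ^ (i * k)]. *)
Lemma insertionE s : insertion s = \sum_(i < size s) (-1 : K) ^ (i%:Z * k) *:
  (tw (take i s) * X (nth 0 s i) * tw (drop i.+1 s)).
Proof.
elim: s => [|m s IHs]; first by rewrite big_ord0.
rewrite /= big_ord_recl /= mul0r scale1r mul1r drop0; congr (_ + _).
rewrite IHs mulr_sumr scaler_sumr; apply: eq_bigr => i _.
rewrite -scalerAr scalerA /bump /= (tword_cons m (take i s)) !mulrA.
by rewrite -expfzDr ?oppr_eq0 ?oner_eq0 // add1n intS mulrDl mul1r.
Qed.

Lemma insertion_tuple (l : nat) (w : l.+1.-tuple Om1) :
  insertion w = \sum_(i < l.+1) (-1 : K) ^ (i%:Z * k) *: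
      (tw (take i w) * X (tnth w i) * tw (drop i.+1 w)).
Proof.
rewrite insertionE size_tuple; apply: eq_bigr => i _.
by rewrite (tnth_nth 0).
Qed.

(** The formula covers nonempty words; the empty word is the unit, of degree zero, where both sides
    vanish. *)
Lemma j_formula_word (D : Om -> Om) : j_formula k X D ->
  forall s, D (tw s) = insertion s.
Proof.
move=> [D0 Dw] [|m s]; first by rewrite /= D0 //; apply: homogeneous_scalar.
by rewrite -[m :: s]/(val (in_tuple (m :: s))) Dw insertion_tuple.
Qed.

Lemma j_formulaI (D : Om -> Om) : (forall x, homogeneous 0 x -> D x = 0) ->
  (forall s, s != [::] -> D (tw s) = insertion s) -> j_formula k X D.
Proof.
move=> D0 Dw; split=> // l w; rewrite -insertion_tuple Dw //.
by rewrite -size_eq0 size_tuple.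
Qed.

(** Scalars and words span [Omega], and the formula fixes a linear map on both. *)
Lemma j_formula_uniq (D E : Om -> Om) : linear D -> linear E ->
  j_formula k X D -> j_formula k X E -> D = E.
Proof.
move=> Dl El jD jE; apply: Omega_eq => // [a|s _].
  by rewrite jD.1 ?jE.1 //; apply: homogeneous_scalar.
by rewrite !j_formula_word.
Qed.

(** * Descent of the alternating sum to a derivation of [Omega] *)

Hypothesis homX : is_hom1 (k + 1) X.

(** By [insertion_cat] the prefix [s1] splits off, leaving words that begin with the slots
    concerned. Balancedness then uses right linearity of [X] at [u] and left linearity at [v]. *)
Lemma insertion_multibal : multibal insertion.
Proof.
have [Xl Xa Xb _] := homX; split=> [s1 s2 c u v|s1 s2 u a v].
  have E : insertion ((c *: u + v) :: s2) =
      c *: insertion (u :: s2) + insertion (v :: s2).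
    rewrite /= Xl tword1_linear !mulrDl !scalerDr -!scalerAl.
    by rewrite (Omega_scalerC _ c) addrACA.
  rewrite !insertion_cat E (tword_lin [::]).
  move: (insertion (u :: s2)) (insertion (v :: s2)) => p q.
  rewrite !mulrDr !scalerDr -!scalerAr.
  by rewrite (Omega_scalerC _ c) addrACA.
have E : insertion (ract u a :: v :: s2) = insertion (u :: lact a v :: s2).
  rewrite /= Xa Xb Omega_lactE Omega_ractE !mulrDr -!scalerAr !mulrA.
  rewrite (@Omega_word_scalar [:: u]) //= -mulrA Omega_scalar_word //.
  rewrite !Omega_wordM; congr (_ + _ *: (_ + _ *: (_ * _))).
  exact: (tword_bal [::]).
by rewrite !insertion_cat E (tword_bal [::]).
Qed.

Definition insertion_map : Om -> Om := word_ext insertion.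

Lemma insertion_map_linear : linear insertion_map.
Proof. exact/word_ext_linear/insertion_multibal. Qed.

Lemma insertion_map_scalar a : insertion_map (sc a) = 0.
Proof. exact/word_ext_scalar/insertion_multibal. Qed.

Lemma insertion_map_word s : insertion_map (tw s) = insertion s.
Proof.
case: s => [|m s]; first exact: insertion_map_scalar.
exact: (word_ext_word insertion_multibal).
Qed.

Lemma insertion_map_algebraic : algebraic insertion_map.
Proof.
apply: (@homogeneous_ind (fun x => insertion_map x = 0) 0).
- by move=> c x y ex ey; rewrite insertion_map_linear ex ey scaler0 addr0.
- by move=> _ a; apply: insertion_map_scalar.
- by case.
Qed.

Lemma insertion_map_formula : j_formula k X insertion_map.
Proof.
by apply: j_formulaI => [|s _];
  [apply: insertion_map_algebraic | apply: insertion_map_word].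
Qed.

Lemma insertion_lact a s : insertion (lact_seq a s) = sc a * insertion s.
Proof.
have [_ Xa _ _] := homX; case: s => [|m s] /=; first by rewrite mulr0.
rewrite Xa Omega_lactE mulrDr -scalerAr !mulrA.
by rewrite (@Omega_scalar_word a [:: m]).
Qed.

(** A right scalar alters only the last letter, so that letter is split off by [insertion_cat]. *)
Lemma insertion_ract s a : insertion (ract_seq s a) = insertion s * sc a.
Proof.
have [_ _ Xb _] := homX; case/lastP: s => [|s m]; first by rewrite mul0r.
rewrite ract_seq_rcons -!cats1 !insertion_cat /= !mulr0 !scaler0 !addr0 !mulr1.
rewrite Xb Omega_ractE mulrDl -scalerAl !mulrA -(mulrA (insertion s)).
by rewrite (@Omega_word_scalar [:: m] a).
Qed.

Lemma insertion_homogeneous s : homogeneous (k + (size s)%:Z) (insertion s).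
Proof.
have [_ _ _ Xh] := homX; elim: s => [|m s IHs] /=; first exact: homogeneous0.
rewrite [X m * _ + _]addrC; apply: homogeneous_lin.
  have := homogeneousM (@homogeneous_word [:: m]) IHs.
  by rewrite addrCA -intS.
by have := homogeneousM (Xh m) (@homogeneous_word s); rewrite -addrA -intS.
Qed.

(** Bilinearity reduces the Leibniz rule to scalars and words. Two words give [insertion_cat]; a
    scalar factor is killed, which leaves [insertion_lact] or [insertion_ract]. *)
Lemma insertion_map_derivation : graded_derivation k insertion_map.
Proof.
have ml := insertion_map_linear; split=> // [l|l x y hx].
  apply: homogeneous_ind => [c x y hx hy|_ a|s _ <-].
  - by rewrite ml; apply: homogeneous_lin.
  - by rewrite insertion_map_scalar; apply: homogeneous0.
  - by rewrite insertion_map_word; apply: insertion_homogeneous.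
move: x hx; apply: homogeneous_ind => [c x x' ex ex'|l0 a|s s0 sl].
- rewrite mulrDl -scalerAl !ml ex ex' !mulrDl !scalerDr -!scalerAl.
  by rewrite (Omega_scalerC _ c) addrACA.
- rewrite l0 mulr0 scale1r insertion_map_scalar mul0r add0r.
  move: y; apply: tensor_algebra_ind => [c y y' ey ey'|b|t t0].
  + by rewrite mulrDr -scalerAr !ml ey ey' mulrDr scalerAr.
  + by rewrite Omega_scalarM !insertion_map_scalar mulr0.
  + by rewrite Omega_scalar_word // !insertion_map_word insertion_lact.
- rewrite insertion_map_word.
  move: y; apply: tensor_algebra_ind => [c y y' ey ey'|b|t t0].
  + rewrite mulrDr -scalerAr !ml ey ey' !mulrDr !scalerDr -!scalerAr.
    by rewrite (Omega_scalerC _ c) addrACA.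
  + rewrite Omega_word_scalar // insertion_map_word insertion_map_scalar.
    by rewrite mulr0 scaler0 addr0 insertion_ract.
  + by rewrite Omega_wordM !insertion_map_word insertion_cat sl.
Qed.

Lemma insertion_map_algder : is_algder k insertion_map.
Proof.
by split; [apply: insertion_map_derivation | apply: insertion_map_algebraic].
Qed.

End Insertion.

(** * Algebraic derivations and their restriction to one-forms *)

Section AlgebraicDerivations.
Set Implicit Arguments.
Unset Strict Implicit.
Unset Printing Implicit Defensive.
Import Order.TTheory.
Local Arguments tword : simpl never.
Variables (K : fieldType) (A : algType K).
Local Notation Om := (Omega A).
Local Notation Om1 := (Omega1 A).
Local Notation tw s := (tword (M := Omega1 A) s : Omega A).
Implicit Types (k : int) (w : Om1).

Lemma hom1P k (X : hom1 A k) : is_hom1 k (hom1_fun X).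
Proof. by have /asboolP := valP X. Qed.

Lemma algderP k (D : algder A k) : is_algder k (algder_fun D).
Proof. by have /asboolP := valP D. Qed.

Lemma hom1_inj k (X Y : hom1 A k) : hom1_fun X =1 hom1_fun Y -> X = Y.
Proof. by move=> E; apply/val_inj/funext. Qed.

Lemma algder_inj k (D E : algder A k) : algder_fun D = algder_fun E -> D = E.
Proof. exact: val_inj. Qed.

Definition mk_hom1 k X (homX : is_hom1 k X) : hom1 A k :=
  @Submodule _ _ (@hom1_pred K A k) X (introT (asboolP _) homX).

Definition mk_algder k D (algD : is_algder k D) : algder A k :=
  @Submodule _ _ (@algder_pred K A k) D (introT (asboolP _) algD).

Definition insertion_der k (X : Om1 -> Om) (homX : is_hom1 (k + 1) X) :
  algder A k := mk_algder (insertion_map_algder homX).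

Definition restriction (D : Om -> Om) w := D (tw [:: w]).

(** Since [D] kills scalars, the Leibniz rule for a product with a scalar loses one term and becomes
    linearity over [A]. *)
Lemma restriction_hom1 k D : is_algder k D -> is_hom1 (k + 1) (restriction D).
Proof.
move=> [[Dl Dh DM] Da]; split=> [c u v|a w|w a|w]; rewrite /restriction.
- by rewrite tword1_linear Dl.
- rewrite -(@Omega_scalar_word _ A a [:: w]) // (DM 0);
    last exact: homogeneous_scalar.
  by rewrite Da ?mul0r ?add0r ?mulr0 ?scale1r //; apply: homogeneous_scalar.
- rewrite -(@Omega_word_scalar _ A [:: w] a) // (DM 1%N);
    last exact: (@homogeneous_word _ _ [:: w]).
  by rewrite [D (tscalar _ _)]Da ?mulr0 ?scaler0 ?addr0 //;
    apply: homogeneous_scalar.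
- exact: (Dh 1%N _ (@homogeneous_word _ _ [:: w])).
Qed.

Lemma restriction_formula k D : is_algder k D -> j_formula k (restriction D) D.
Proof.
move=> [[Dl Dh DM] Da]; apply: j_formulaI => // s _.
elim: s => [|m s IHs] /=; first by rewrite Da //; apply: homogeneous_scalar.
rewrite tword_cons (DM 1%N); last exact: (@homogeneous_word _ _ [:: m]).
by rewrite IHs mulr1.
Qed.

(** On a one-letter word the sum is a single term with sign [1], so [X] is recovered from its map;
    this gives injectivity. *)
Lemma formula_restriction k X D : j_formula k X D -> restriction D =1 X.
Proof.
move=> jD w; rewrite /restriction (j_formula_word jD) /=.
by rewrite mulr0 scaler0 addr0 mulr1.
Qed.

Lemma algder_eq0 k (D : algder A k) : k < -1 -> D = 0.
Proof.
move=> k1; have algD := algderP D; apply: algder_inj.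
have [_ _ _ Xh] := restriction_hom1 algD.
have [[zl _ _] _] := algderP (0 : algder A k).
have [[Dl _ _] _] := algD.
(* The values have degree [k + 1], which is negative, so both restrictions are zero. *)
have E : restriction (algder_fun D) =1
    restriction (algder_fun (0 : algder A k)).
  by move=> w; apply: homogeneous_neg (Xh w); rewrite -ltrBrDr sub0r.
apply: (j_formula_uniq Dl zl (restriction_formula algD)).
by rewrite (funext E); apply: restriction_formula; apply: algderP.
Qed.

(** * The isomorphism in a single degree, with its shift by one *)

Lemma hom1_natP m (X : hom1_nat A m) :
  is_hom1 (m%:Z - 1 + 1) (hom1_fun (X : hom1 A m%:Z)).
Proof. by rewrite subrK; apply: hom1P. Qed.

Definition nat_der m (X : hom1_nat A m) : algder A (m%:Z - 1) :=
  insertion_der (hom1_natP X).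

Fact nat_hom_subproof m (D : algder A (m%:Z - 1)) :
  is_hom1 m%:Z (restriction (algder_fun D)).
Proof. by have := restriction_hom1 (algderP D); rewrite subrK. Qed.

Definition nat_hom m (D : algder A (m%:Z - 1)) : hom1_nat A m :=
  mk_hom1 (nat_hom_subproof D).

Lemma nat_der_formula m (X : hom1_nat A m) :
  j_formula (m%:Z - 1) (hom1_fun (X : hom1 A m%:Z)) (algder_fun (nat_der X)).
Proof. exact: insertion_map_formula (hom1_natP X). Qed.

Lemma nat_derK m : cancel (@nat_der m) (@nat_hom m).
Proof.
by move=> X; apply: hom1_inj => w; apply/formula_restriction/nat_der_formula.
Qed.

Lemma nat_homK m : cancel (@nat_hom m) (@nat_der m).
Proof.
move=> D; apply: algder_inj.
have [[Dl _ _] _] := algderP D.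
have [[El _ _] _] := algderP (nat_der (nat_hom D)).
apply: (j_formula_uniq El Dl (nat_der_formula _)).
exact: restriction_formula (algderP D).
Qed.

Lemma nat_hom_linear m : linear (@nat_hom m).
Proof. by move=> c D E; apply: hom1_inj. Qed.

(** [nat_der] inverts the restriction, whose linearity is immediate, so linearity carries over
    without computing insertions. *)
Lemma nat_der_linear m : linear (@nat_der m).
Proof.
move=> c X Y; apply: (can_inj (@nat_homK m)).
by rewrite nat_hom_linear !nat_derK.
Qed.

Lemma nat_hom0 m : nat_hom (0 : algder A (m%:Z - 1)) = 0.
Proof. exact: hom1_inj. Qed.

Lemma nat_der0 m : nat_der (0 : hom1_nat A m) = 0.
Proof. by rewrite -(nat_hom0 m) nat_homK. Qed.

(** * The isomorphism of direct sums *)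

Definition star_der : hom1_star A -> algder_star A :=
  dlift (fun m (X : hom1_nat A m) => dinj (nat_der X) : algder_star A).

Lemma star_der_comp_linear m c (X Y : hom1_nat A m) :
  dinj (nat_der (c *: X + Y)) =
  c *: dinj (nat_der X) + dinj (nat_der Y) :> algder_star A.
Proof. by rewrite nat_der_linear dinjP. Qed.

Lemma star_der_linear : linear star_der.
Proof.
by move=> c X Y; apply: dliftP => m d U V; apply: star_der_comp_linear.
Qed.

Lemma star_der_dinj m (X : hom1_nat A m) :
  star_der (dinj X) = dinj (nat_der X).
Proof. by apply: dlift_inj => n c U V; apply: star_der_comp_linear. Qed.

(** The shift from [m] to [m - 1] is injective, so summands of different index land in different
    degrees and do not mix. *)
Lemma star_derE (X : hom1_star A) m : star_der X (m%:Z - 1) = nat_der (X m).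
Proof.
elim/dsum_ind: X => [c X Y eX eY|n X|].
- by rewrite star_der_linear dsumDE dsumZE eX eY -nat_der_linear.
- rewrite star_der_dinj; have [<-|nm] := eqVneq n m; first by rewrite !dinj_in.
  rewrite !dinj_out ?nat_der0 //; apply: contraNneq nm => E.
  by move: E => /addIr/eqP; rewrite eqz_nat.
- have := star_der_linear (-1) 0 0.
  rewrite scaler0 addr0 scaleN1r addNr => ->.
  by rewrite !dsum0E nat_der0.
Qed.

Fact star_hom_subproof (D : algder_star A) :
  exists s : seq nat, forall m, m \notin s -> nat_hom (D (m%:Z - 1)) = 0.
Proof.
(* On degrees at least [-1] the shift is inverted by [absz (k + 1)]; lower degrees in [s] only
   enlarge the list. *)
have [s hs] := dsum_finite D; exists [seq absz (k + 1) | k <- s] => m ms.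
rewrite hs ?nat_hom0 //; apply: contra ms => ms.
by apply/mapP; exists (m%:Z - 1) => //; rewrite subrK.
Qed.

(** Components of degree below [-1] are dropped; they vanish by [algder_eq0]. *)
Definition star_hom (D : algder_star A) : hom1_star A :=
  DSum (star_hom_subproof D).

Lemma star_derK : cancel star_der star_hom.
Proof. by move=> X; apply: dsumP => m /=; rewrite star_derE nat_derK. Qed.

Lemma star_homK : cancel star_hom star_der.
Proof.
(* Below [-1] both components vanish; any other degree is [m - 1] for a natural number [m]. *)
move=> D; apply: dsumP => k; have [k1|k1] := ltP k (-1).
  by rewrite (algder_eq0 (D k) k1); apply: algder_eq0.
have {k1} : 0 <= k + 1 by rewrite -lerBlDr sub0r.
case E: (k + 1) => [m|//] _; have -> : k = m%:Z - 1 by rewrite -E addrK.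
by rewrite star_derE /= nat_homK.
Qed.

HB.instance Definition _ := GRing.isLinear.Build K (hom1_star A)
  (algder_star A) *:%R star_der star_der_linear.

End AlgebraicDerivations.

Theorem mainTheorem1 (K : fieldType) (charK : [pchar K] =i pred0)
    (A : algType K) :
  [/\ forall (k : int) (X : hom1 A (k + 1)), -1 <= k ->
        exists D : algder A k, j_formula k (hom1_fun X) (algder_fun D) /\
          forall D' : Omega A -> Omega A,
            linear D' -> j_formula k (hom1_fun X) D' -> D' = algder_fun D,
      forall (k : int) (D : algder A k),
        exists X : hom1 A (k + 1), j_formula k (hom1_fun X) (algder_fun D)
    & exists J : {linear hom1_star A -> algder_star A}, bijective J /\
        forall (m : nat) (X : hom1 A m%:Z),
          exists2 D : algder A (m%:Z - 1),
            j_formula (m%:Z - 1) (hom1_fun X) (algder_fun D)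
            & J (@dinj K nat (hom1_nat A) m X) =
              @dinj K int (algder A) (m%:Z - 1) D].
Proof.
split=> [k X _|k D|].
- exists (insertion_der (hom1P X)).
  have jX := insertion_map_formula (hom1P X); split=> // D' D'l jD'.
  exact: j_formula_uniq (insertion_map_linear (hom1P X)) jD' jX.
- have XP := restriction_hom1 (algderP D).
  exists (mk_hom1 XP).
  exact: restriction_formula (algderP D).
- exists (@star_der K A); split.
    by exists (@star_hom K A); [apply: star_derK | apply: star_homK].
  move=> m X; exists (nat_der X); first exact: nat_der_formula.
  exact: star_der_dinj.
Qed.
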